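(* Consider the Hamiltonian $$H=\tfrac12(p_x^2+p_y^2+p_z^2)+yp_x-xp_y-\frac1{\omega^2}\left(\sum_{i=1}^3\frac{m_i}{r_i}+\frac{m_3R_3^2}{r_3^3}\left(\frac{C_{20}}{2}\right)(3\sin^2\phi-1)\right)$$ of the spatial circular restricted four-body problem with oblate tertiary (all quantities are defined in the context). Shift the origin of the reference frame so that it coincides with $m_3$, and perform the conformal symplectic scaling given by $$(x,y,z,p_x,p_y,p_z)\rightarrow m_3^{1/3}(x,y,z,p_x,p_y,p_z).$$ Accordingly, rescale the average radius of the tertiary as $R_3=m_3^{1/3}\rho_3$. Expanding the resulting Hamiltonian as a power series in $m_3^{1/3}$ and neglecting all the terms of order $O(m_3^{1/3})$ in the expansion, one obtains the following Hamiltonian describing the Hill four-body problem with oblate tertiary: $$\begin{aligned} H=&\ \tfrac12(p_x^2+p_y^2+p_z^2)+yp_x-xp_y\\ &+\frac{4-3v^2}{8}x^2+\frac{3v^2-8}{8}y^2+\frac12z^2-\frac{3v\sqrt{4-v^2}}{4}(1-2\mu)xy\\ &-\frac{1}{(x^2+y^2+z^2)^{1/2}}-\left(\frac{\rho_3^2C_{20}}{2}\right)\frac{1}{(x^2+y^2+z^2)^{3/2}}\left(\frac{3z^2}{x^2+y^2+z^2}-1\right)\\ =&\ \tfrac12(p_x^2+p_y^2+p_z^2)+yp_x-xp_y\\ &+\frac{4-3v^2}{8}x^2+\frac{3v^2-8}{8}y^2+\frac12z^2-\frac{3v\sqrt{4-v^2}}{4}(1-2\mu)xy\\ &-\frac{1}{(x^2+y^2+z^2)^{1/2}}-\frac{c}{(x^2+y^2+z^2)^{3/2}}\left(\frac{3z^2}{x^2+y^2+z^2}-1\right),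 \end{aligned}$$ where $v=\left(\frac{1}{1-\frac32R_3^2C_{20}}\right)^{1/3}$, $\mu=\frac{m_2}{m_1+m_2}$, and $c:=\rho_3^2C_{20}/2=m_3^{-2/3}R_3^2C_{20}/2$.
   Context: Three heavy bodies of masses $m_1\ge m_2\ge m_3$ (primary, secondary, tertiary), normalized so that $m_1+m_2+m_3=1$, move on circular orbits forming a triangular central configuration; $m_1,m_2$ are point masses and $m_3$ is oblate, with average radius $R_3$ and zonal harmonic coefficient $C_{20}=-J_2<0$. An infinitesimal body moves in space under their attraction without affecting them. The heavy bodies form an isosceles triangle with $r_{13}=r_{23}=1$ and $r_{12}=v$, where $v$ is as in the claim, and their angular velocity is $\omega=\sqrt{1-\frac32R_3^2C_{20}}$. In the frame rotating with them, with center of mass at the origin and $m_1$ on the negative $x$-semi-axis, they are at $(x_i,y_i,0)$, where, with $S=\sqrt{v^2m_2^2+v^2m_2m_3+m_3^2}$, $$x_1=-S,\quad y_1=0,\quad x_2=\frac{2v^2m_2+v^2m_3-2S^2}{2S},\quad y_2=-\frac{v\sqrt{4-v^2}\,m_3}{2S},$$ $$x_3=\frac{v^2m_2+2m_3-2S^2}{2S},\quad y_3=\frac{v\sqrt{4-v^2}\,m_2}{2S}.$$ Time is rescaled so that the angular velocity becomes $1$. Here $r_i=\left((x-x_i)^2+(y-y_i)^2+z^2\right)^{1/2}$ is the distance from the infinitesimal body to $m_i$, $\sin\phi=z/r_3$, and $(x,y,z,p_x,p_y,p_z)$ are symplectic coordinates with $\dot x=p_x+y$, $\dot y=p_y-x$,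 $\dot z=p_z$. *)

(* Defs.v *)
From Stdlib Require Import Reals.
From Coquelicot Require Import Coquelicot.
Open Scope R_scope.

(* A point (x, y, z, p_x, p_y, p_z). *)
Definition phase : Type := (R * R * R * R * R * R)%type.

(* Angular velocity before time is rescaled, and the side r_12 of the triangle
   (the other two sides are 1); v^3 = 1 / omega^2. *)
Definition omega (R3 C20 : R) : R := sqrt (1 - 3 / 2 * R3 ^ 2 * C20).

Definition side (R3 C20 : R) : R :=
  Rpower (1 / (1 - 3 / 2 * R3 ^ 2 * C20)) (1 / 3).

(* Positions of the heavy bodies; here v is the length r_12. *)
Definition posS (v m2 m3 : R) : R :=
  sqrt (v ^ 2 * m2 ^ 2 + v ^ 2 * m2 * m3 + m3 ^ 2).

Definition x1 (v m2 m3 : R) : R := - posS v m2 m3.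
Definition y1 : R := 0.
Definition x2 (v m2 m3 : R) : R :=
  (2 * v ^ 2 * m2 + v ^ 2 * m3 - 2 * posS v m2 m3 ^ 2) / (2 * posS v m2 m3).
Definition y2 (v m2 m3 : R) : R :=
  - (v * sqrt (4 - v ^ 2) * m3 / (2 * posS v m2 m3)).
Definition x3 (v m2 m3 : R) : R :=
  (v ^ 2 * m2 + 2 * m3 - 2 * posS v m2 m3 ^ 2) / (2 * posS v m2 m3).
Definition y3 (v m2 m3 : R) : R :=
  v * sqrt (4 - v ^ 2) * m2 / (2 * posS v m2 m3).

(* Distance from (x, y, z) to (a, b, 0). *)
Definition dist_to (a b x y z : R) : R :=
  sqrt ((x - a) ^ 2 + (y - b) ^ 2 + z ^ 2).

Definition H4body (m1 m2 m3 R3 C20 : R) (w : phase) : R :=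
  let '(x, y, z, px, py, pz) := w in
  let v := side R3 C20 in
  let r1 := dist_to (x1 v m2 m3) y1 x y z in
  let r2 := dist_to (x2 v m2 m3) (y2 v m2 m3) x y z in
  let r3 := dist_to (x3 v m2 m3) (y3 v m2 m3) x y z in
  let sin_phi := z / r3 in
  1 / 2 * (px ^ 2 + py ^ 2 + pz ^ 2) + y * px - x * py
  - 1 / omega R3 C20 ^ 2 *
    (m1 / r1 + m2 / r2 + m3 / r3
     + m3 * R3 ^ 2 / r3 ^ 3 * (C20 / 2) * (3 * sin_phi ^ 2 - 1)).

(* Old coordinates in terms of the coordinates with origin at (a, b, 0). The
   velocities do not change, so the relations x' = p_x + y, y' = p_y - x,
   z' = p_z, required in both frames, determine the shift of the momenta. *)
Definition shift (a b : R) (w : phase) : phase :=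
  let '(x, y, z, px, py, pz) := w in (x + a, y + b, z, px - b, py + a, pz).

Definition scaling (s : R) (w : phase) : phase :=
  let '(x, y, z, px, py, pz) := w in
  (s * x, s * y, s * z, s * px, s * py, s * pz).

(* The symplectic form dx/\dp_x + dy/\dp_y + dz/\dp_z. *)
Definition sympl (u u' : phase) : R :=
  let '(x, y, z, px, py, pz) := u in
  let '(x', y', z', px', py', pz') := u' in
  (x * px' - px * x') + (y * py' - py * y') + (z * pz' - pz * z').

Definition conformally_symplectic (lambda : R) (T : phase -> phase) : Prop :=
  forall w : phase, exists dT : phase -> phase,
    filterdiff T (locally w) dT /\
    forall u u' : phase, sympl (dT u) (dT u') = lambda * sympl u u'.

(* If w = T w' with T conformally symplectic of factor lambda <> 0, Hamilton's
   equations of H in w become those of lambda^-1 * (H o T) in w'. *)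
Definition transformed (lambda : R) (T : phase -> phase) (H : phase -> R)
  (w : phase) : R := / lambda * H (T w).

(* Old coordinates in terms of the coordinates centred at the tertiary and
   scaled by m3^(1/3). *)
Definition hill_change (m2 m3 R3 C20 : R) (w : phase) : phase :=
  let v := side R3 C20 in
  shift (x3 v m2 m3) (y3 v m2 m3) (scaling (Rpower m3 (1 / 3)) w).

Definition quadratic_part (mu v : R) (w : phase) : R :=
  let '(x, y, z, px, py, pz) := w in
  1 / 2 * (px ^ 2 + py ^ 2 + pz ^ 2) + y * px - x * py
  + (4 - 3 * v ^ 2) / 8 * x ^ 2 + (3 * v ^ 2 - 8) / 8 * y ^ 2 + 1 / 2 * z ^ 2
  - 3 * v * sqrt (4 - v ^ 2) / 4 * (1 - 2 * mu) * x * y.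

(* Rpower is only meaningful at a positive base, so (x^2+y^2+z^2)^(1/2) is
   written with sqrt. *)
Definition Hhill_rho (mu v rho3 C20 : R) (w : phase) : R :=
  let '(x, y, z, px, py, pz) := w in
  quadratic_part mu v w
  - 1 / sqrt (x ^ 2 + y ^ 2 + z ^ 2)
  - rho3 ^ 2 * C20 / 2 * (1 / sqrt (x ^ 2 + y ^ 2 + z ^ 2) ^ 3)
    * (3 * z ^ 2 / (x ^ 2 + y ^ 2 + z ^ 2) - 1).

Definition Hhill_c (mu v c : R) (w : phase) : R :=
  let '(x, y, z, px, py, pz) := w in
  quadratic_part mu v w
  - 1 / sqrt (x ^ 2 + y ^ 2 + z ^ 2)
  - c / sqrt (x ^ 2 + y ^ 2 + z ^ 2) ^ 3
    * (3 * z ^ 2 / (x ^ 2 + y ^ 2 + z ^ 2) - 1).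

Definition off_tertiary (w : phase) : Prop :=
  let '(x, y, z, _, _, _) := w in (x, y, z) <> (0, 0, 0).

(* The systems with given mu = m2 / (m1 + m2), rho3 and C20; they form a
   one-parameter family, parametrized by m3. *)
Definition admissible (mu rho3 m1 m2 m3 R3 : R) : Prop :=
  m1 >= m2 /\ m2 >= m3 /\ m3 > 0 /\ m1 + m2 + m3 = 1 /\
  mu = m2 / (m1 + m2) /\ R3 = Rpower m3 (1 / 3) * rho3.

(* Main.v *)
Require Import Defs.
From Stdlib Require Import Reals Arith Lra Lia.
From Coquelicot Require Import Coquelicot.
Open Scope R_scope.

(** With [s = m3^(1/3)], the shifted and scaled Hamiltonian is [s^-2] times a function
    of [s]. The distances from the tertiary to the two other bodies are 1, so
    [r_i^2 = 1 + s t_i] with [t_i] analytic in [s], and [1 / r_i] is expanded to second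
    order in [s t_i]. Besides the constants collected in [E], the terms of order
    [s^-1] cancel because the center of mass is at the origin, up to a factor
    [1 - v^3 = O(s^2)], and the terms of order [s^0] give the Hill quadratic form: the
    directions to the tertiary, at fixed [v], differ from their limits by [O(s^3)].
    What is left is [s] times an explicit function of [s] and the position.

    That function is analytic at [s = 0], locally uniformly in the position: power series
    with uniform geometric bounds are closed under the ring operations and under
    [f |-> f^p] for [|p| <= 1] and [f(0) > 0], since the coefficients of [g = f^p] solve
    the recursion expressing [f g' = p f' g]. *)

(** * Uniformly analytic families *)

(** [r] is the inverse of a radius, so several bounds are brought to a common one by enlarging [r]
    and [B]. *)
Definition geometric (r B : R) (a : nat -> R) : Prop :=
  forall n : nat, Rabs (a n) <= B * r ^ n.

(** The terms [a n * (/ r) ^ n] are bounded by [B], so the radius of convergence is at least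
    [/ r]. *)
Lemma geometric_radius (r B s : R) (a : nat -> R) :
  0 < r -> geometric r B a -> Rabs s * r < 1 -> Rbar_lt (Rabs s) (CV_radius a).
Proof.
  intros hr ha hs.
  apply Rbar_lt_le_trans with (Finite (/ r)).
  - simpl. apply Rmult_lt_reg_r with r; [exact hr|].
    rewrite Rinv_l by lra. exact hs.
  - destruct (CV_radius_bounded a) as [ub _]. apply (ub (/ r)).
    exists B. intros n.
    rewrite Rabs_mult, (Rabs_pos_eq ((/ r) ^ n))
      by (apply pow_le, Rlt_le, Rinv_0_lt_compat, hr).
    rewrite pow_inv. assert (hp : 0 < r ^ n) by now apply pow_lt.
    apply Rmult_le_reg_r with (r ^ n); [exact hp|].
    rewrite Rmult_assoc, Rinv_l by lra. rewrite Rmult_1_r. apply ha.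
Qed.

Lemma geometric_weaken (r B r' B' : R) (a : nat -> R) :
  0 <= r <= r' -> 0 <= B <= B' -> geometric r B a -> geometric r' B' a.
Proof.
  intros hr hB ha n. apply Rle_trans with (1 := ha n).
  apply Rmult_le_compat; [lra | apply pow_le; lra | lra | now apply pow_incr].
Qed.

(** Domination by a geometric series of ratio at most 1/2, whose sum is at most 2. *)
Lemma geometric_PSeries_bound (r B s : R) (a : nat -> R) :
  0 < r -> geometric r B a -> Rabs s * r <= 1 / 2 -> Rabs (PSeries a s) <= 2 * B.
Proof.
  intros hr ha hs.
  assert (hB : 0 <= B).
  { specialize (ha O). simpl in ha. pose proof (Rabs_pos (a O)). lra. }
  assert (hq : 0 <= Rabs s * r) by (apply Rmult_le_pos; [apply Rabs_pos | lra]).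
  assert (hq1 : Rabs (Rabs s * r) < 1) by (rewrite Rabs_pos_eq; lra).
  unfold PSeries. eapply Rle_trans; [apply Series_Rabs|].
  - apply CV_disk_inside. apply (geometric_radius r B); [exact hr | exact ha | lra].
  - apply Rle_trans with (Series (fun n => B * (Rabs s * r) ^ n)).
    + apply Series_le.
      * intros n. split; [apply Rabs_pos|].
        rewrite Rabs_mult, <- RPow_abs, Rpow_mult_distr.
        replace (B * (Rabs s ^ n * r ^ n)) with (B * r ^ n * Rabs s ^ n) by ring.
        apply Rmult_le_compat_r; [apply pow_le, Rabs_pos | apply ha].
      * apply (ex_series_scal B (fun n => (Rabs s * r) ^ n)).
        now apply ex_series_geom.
    + rewrite Series_scal_l, Series_geom by exact hq1.
      rewrite (Rmult_comm 2). apply Rmult_le_compat_l; [exact hB|].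
      apply Rmult_le_reg_r with (1 - Rabs s * r); [lra|].
      rewrite Rinv_l by lra. lra.
Qed.

Lemma geometric_plus (r B B' : R) (a b : nat -> R) :
  geometric r B a -> geometric r B' b -> geometric r (B + B') (PS_plus a b).
Proof.
  intros ha hb n. specialize (ha n). specialize (hb n).
  eapply Rle_trans; [apply Rabs_triang|]. lra.
Qed.

Lemma INR_S_le_pow2 (n : nat) : INR (S n) <= 2 ^ n.
Proof.
  induction n as [|n IH]; [simpl; lra|].
  rewrite S_INR. simpl pow.
  pose proof (pow_R1_Rle 2 n ltac:(lra)). lra.
Qed.

(** Each of the [n + 1] products is at most [B * B' * r ^ n], and doubling the rate absorbs the
    factor [n + 1 <= 2 ^ n]. *)
Lemma geometric_mult (r B B' : R) (a b : nat -> R) :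
  0 < r -> geometric r B a -> geometric r B' b ->
  geometric (2 * r) (B * B') (PS_mult a b).
Proof.
  intros hr ha hb n. unfold PS_mult.
  assert (hrn : 0 < r ^ n) by now apply pow_lt.
  assert (hBB : 0 <= B * B').
  { specialize (ha O). specialize (hb O). simpl in ha, hb.
    pose proof (Rabs_pos (a O)). pose proof (Rabs_pos (b O)).
    apply Rmult_le_pos; lra. }
  eapply Rle_trans; [apply sum_f_R0_triangle|].
  apply Rle_trans with (sum_f_R0 (fun _ => B * B' * r ^ n) n).
  - apply sum_Rle. intros k hk. rewrite Rabs_mult.
    replace (B * B' * r ^ n) with ((B * r ^ k) * (B' * r ^ (n - k))).
    + apply Rmult_le_compat; [apply Rabs_pos | apply Rabs_pos | apply ha | apply hb].
    + replace (r ^ n) with (r ^ k * r ^ (n - k)); [ring|].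
      rewrite <- pow_add. f_equal. lia.
  - rewrite sum_cte, Rpow_mult_distr.
    pose proof (INR_S_le_pow2 n).
    replace (B * B' * (2 ^ n * r ^ n)) with (B * B' * r ^ n * 2 ^ n) by ring.
    apply Rmult_le_compat_l; [|exact H].
    apply Rmult_le_pos; lra.
Qed.

(* The recursion expresses [f * g' = p * f' * g], which characterizes [g = f ^ p]
   when [f 0 = g 0 = 1]; [pow_table n] tabulates its solution up to index [n]. *)
Fixpoint pow_table (p : R) (f : nat -> R) (n k : nat) : R :=
  match n with
  | O => 1
  | S m =>
      if Nat.leb k m then pow_table p f m k
      else / INR (S m)
           * sum_f_R0 (fun j => (p * INR (S j) - INR (m - j)) * f (S j)
                                * pow_table p f m (m - j)) m
  end.

Definition pow_coef (p : R) (f : nat -> R) (n : nat) : R := pow_table p f n n.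

Lemma pow_table_coef (p : R) (f : nat -> R) (n k : nat) :
  (k <= n)%nat -> pow_table p f n k = pow_coef p f k.
Proof.
  induction n as [|n IH]; intros hk.
  - now replace k with O by lia.
  - simpl. destruct (Nat.leb_spec k n) as [h|h]; [now apply IH|].
    replace k with (S n) by lia. unfold pow_coef. cbn [pow_table].
    destruct (Nat.leb_spec (S n) n); [lia|]. reflexivity.
Qed.

Lemma pow_coef_rec (p : R) (f : nat -> R) (n : nat) :
  INR (S n) * pow_coef p f (S n)
  = sum_f_R0 (fun j => (p * INR (S j) - INR (n - j)) * f (S j)
                       * pow_coef p f (n - j)) n.
Proof.
  unfold pow_coef at 1. cbn [pow_table].
  destruct (Nat.leb_spec (S n) n); [lia|].
  rewrite <- Rmult_assoc, Rinv_r, Rmult_1_l by (apply not_0_INR; lia).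
  apply sum_eq. intros j hj. rewrite pow_table_coef by lia. reflexivity.
Qed.

Lemma sum_geom_rev (q : R) (n : nat) :
  sum_f_R0 (fun j => q ^ (n - j)) n * (q - 1) = q ^ S n - 1.
Proof.
  induction n as [|n IH]; [simpl; ring|].
  rewrite decomp_sum by lia. cbn [Nat.pred Nat.sub].
  rewrite Rmult_plus_distr_r, IH. simpl. ring.
Qed.

(** Strong induction on the recursion. Since [Rabs p <= 1], the weight [p * INR (S j) - INR (n - j)]
    is at most [INR (S n)] in absolute value, which cancels the factor on the left. The rate
    [(1 + B) * r] makes the remaining sum geometric: [B] times the sum of the [(1 + B) ^ (n - j)] is
    [(1 + B) ^ S n - 1]. *)
Lemma geometric_pow_coef (p r B : R) (f : nat -> R) :
  Rabs p <= 1 -> 0 < r -> 0 <= B -> geometric r B f ->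
  geometric ((1 + B) * r) 1 (pow_coef p f).
Proof.
  intros hp hr hB hf n. rewrite Rmult_1_l.
  induction n as [n IH] using (well_founded_induction lt_wf). destruct n as [|n].
  - unfold pow_coef. simpl. rewrite Rabs_R1. lra.
  - assert (hS : 0 < INR (S n)) by (apply lt_0_INR; lia).
    apply Rmult_le_reg_l with (INR (S n)); [exact hS|].
    rewrite <- (Rabs_pos_eq (INR (S n))) at 1 by lra.
    rewrite <- Rabs_mult, pow_coef_rec.
    eapply Rle_trans; [apply sum_f_R0_triangle|].
    apply Rle_trans
      with (sum_f_R0 (fun j => (1 + B) ^ (n - j) * (INR (S n) * B * r ^ S n)) n).
    + apply sum_Rle. intros j hj. rewrite !Rabs_mult.
      replace ((1 + B) ^ (n - j) * (INR (S n) * B * r ^ S n))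
        with (INR (S n) * (B * r ^ S j) * ((1 + B) * r) ^ (n - j)).
      * apply Rmult_le_compat; [|apply Rabs_pos | | apply IH; lia].
        -- apply Rmult_le_pos; apply Rabs_pos.
        -- apply Rmult_le_compat; [apply Rabs_pos | apply Rabs_pos | | apply hf].
           assert (e : INR (S n) = INR (S j) + INR (n - j))
             by (rewrite <- plus_INR; f_equal; lia).
           pose proof (pos_INR (n - j)). pose proof (pos_INR (S j)).
           apply Rabs_le_between in hp. apply Rabs_le. rewrite e. nra.
      * rewrite Rpow_mult_distr.
        replace (r ^ S n) with (r ^ S j * r ^ (n - j))
          by (rewrite <- pow_add; f_equal; lia). ring.
    + rewrite <- scal_sum.
      pose proof (sum_geom_rev (1 + B) n) as e.
      replace (1 + B - 1) with B in e by ring.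
      replace (INR (S n) * B * r ^ S n * sum_f_R0 (fun j => (1 + B) ^ (n - j)) n)
        with (INR (S n) * (r ^ S n * ((1 + B) ^ S n - 1))) by (rewrite <- e; ring).
      apply Rmult_le_compat_l; [lra|]. rewrite Rpow_mult_distr.
      pose proof (pow_lt r (S n) hr). lra.
Qed.

(** A rearrangement of the recursion: [f O = 1] turns the first summand of [f * g'] into
    [INR (S n) * g (S n)]. *)
Lemma pow_coef_ode (p : R) (f : nat -> R) (n : nat) :
  f O = 1 ->
  PS_mult f (PS_derive (pow_coef p f)) n
  = p * PS_mult (PS_derive f) (pow_coef p f) n.
Proof.
  intros f0. unfold PS_mult, PS_derive. set (g := pow_coef p f).
  rewrite scal_sum.
  assert (e : INR (S n) * g (S n)
    = sum_f_R0 (fun j => INR (S j) * f (S j) * g (n - j)%nat * p) n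
      - sum_f_R0 (fun j => INR (n - j) * (f (S j) * g (n - j)%nat)) n).
  { unfold g at 1. rewrite pow_coef_rec, <- minus_sum.
    apply sum_eq. intros j hj. fold g. ring. }
  destruct n as [|n].
  - simpl in e |- *. rewrite f0. lra.
  - rewrite decomp_sum by lia. rewrite f0, Nat.sub_0_r, Rmult_1_l, e.
    (* The last summand carries [INR 0]; without it the sum has the same indices as the rest of the
       left-hand side. *)
    cbn [Nat.pred]. rewrite (tech5 (fun j => INR (S n - j) * _)), Nat.sub_diag.
    rewrite (sum_eq (fun i => f (S i) * _)
              (fun j => INR (S n - j) * (f (S j) * g (S n - j)%nat)) n).
    + simpl INR. ring.
    + intros i hi. replace (S (S n - S i)) with (S n - i)%nat by lia. ring.
Qed.

Lemma geometric_decr (r B : R) (a : nat -> R) :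
  geometric r B a -> geometric r (B * r) (PS_decr_1 a).
Proof.
  intros ha n. unfold PS_decr_1. specialize (ha (S n)). simpl in ha.
  eapply Rle_trans; [exact ha|]. right. ring.
Qed.

(** Factoring [s] out of the tail turns a bound on the shifted series into a Lipschitz estimate at
    0. *)
Lemma geometric_PSeries_near (r B s : R) (a : nat -> R) :
  0 < r -> geometric r B a -> Rabs s * r <= 1 / 2 ->
  Rabs (PSeries a s - a O) <= 2 * B * r * Rabs s.
Proof.
  intros hr ha hs.
  rewrite PSeries_decr_1
    by (apply CV_radius_inside, (geometric_radius r B); [exact hr | exact ha | lra]).
  replace (a O + s * PSeries (PS_decr_1 a) s - a O)
    with (s * PSeries (PS_decr_1 a) s) by ring.
  rewrite Rabs_mult.
  pose proof (geometric_PSeries_bound _ _ _ _ hr (geometric_decr _ _ _ ha) hs).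
  pose proof (Rabs_pos s). nra.
Qed.

(** By [f * g' = p * f' * g], the product [g * f ^ (- p)] has derivative zero, and its value at 0 is
    1. The bound on [s] keeps both series convergent and [f] positive at every [t] with
    [Rabs t <= Rabs s]. *)
Lemma PSeries_pow_coef (p r B s : R) (f : nat -> R) :
  Rabs p <= 1 -> 0 < r -> 0 <= B -> geometric r B f -> f O = 1 ->
  Rabs s * (2 * (1 + B) * r) < 1 ->
  0 < PSeries f s /\ PSeries (pow_coef p f) s = Rpower (PSeries f s) p.
Proof.
  intros hp hr hB hf f0 hs.
  set (g := pow_coef p f). set (r' := (1 + B) * r).
  assert (hr' : 0 < r') by (unfold r'; nra).
  assert (hg : geometric r' 1 g) by now apply geometric_pow_coef.
  assert (hc : forall t, Rabs t <= Rabs s ->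
    0 <= Rabs t * r /\ 0 <= Rabs t * r * B
    /\ 2 * (Rabs t * r) + 2 * (Rabs t * r * B) < 1).
  { intros t ht. pose proof (Rabs_pos t).
    assert (h1 : 0 <= Rabs t * r) by nra.
    assert (h2 : 0 <= Rabs t * r * B) by nra.
    split; [exact h1 | split; [exact h2|]].
    apply Rle_lt_trans with (Rabs s * (2 * (1 + B) * r)); [|exact hs].
    replace (2 * (Rabs t * r) + 2 * (Rabs t * r * B))
      with (Rabs t * (2 * (1 + B) * r)) by ring.
    apply Rmult_le_compat_r; nra. }
  assert (Hf : forall t, Rabs t <= Rabs s -> Rbar_lt (Rabs t) (CV_radius f)).
  { intros t ht. apply (geometric_radius r B); [exact hr | exact hf |].
    specialize (hc t ht). lra. }
  assert (Hg : forall t, Rabs t <= Rabs s -> Rbar_lt (Rabs t) (CV_radius g)).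
  { intros t ht. apply (geometric_radius r' 1); [exact hr' | exact hg |].
    specialize (hc t ht). unfold r'. lra. }
  assert (hpos : forall t, Rabs t <= Rabs s -> 0 < PSeries f t).
  { intros t ht. specialize (hc t ht).
    assert (h : Rabs t * r <= 1 / 2) by lra.
    pose proof (geometric_PSeries_near r B t f hr hf h) as k.
    rewrite f0 in k. apply Rabs_le_between in k. lra. }
  split; [apply hpos; lra|].
  assert (ode : forall t, Rabs t <= Rabs s ->
    PSeries f t * PSeries (PS_derive g) t = p * (PSeries (PS_derive f) t * PSeries g t)).
  { intros t ht.
    rewrite <- PSeries_mult by (rewrite ?CV_radius_derive; auto).
    rewrite <- PSeries_mult by (rewrite ?CV_radius_derive; auto).
    rewrite <- PSeries_scal. apply PSeries_ext. intros n.
    unfold PS_scal. now apply pow_coef_ode. }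
  set (phi := fun t => PSeries g t * Rpower (PSeries f t) (- p)).
  assert (dphi : forall t, Rabs t <= Rabs s -> is_derive phi t zero).
  { intros t ht. specialize (hpos t ht). specialize (ode t ht).
    unfold phi, Rpower.
    evar_last.
    - apply (is_derive_mult (PSeries g) (fun t => exp (- p * ln (PSeries f t)))).
      + apply is_derive_PSeries; auto.
      + apply (is_derive_comp exp (fun t => - p * ln (PSeries f t))).
        * apply is_derive_Reals, derivable_pt_lim_exp.
        * apply (is_derive_scal (fun t => ln (PSeries f t)) t (- p)).
          apply (is_derive_comp ln (PSeries f)).
          -- apply is_derive_Reals, derivable_pt_lim_ln. exact hpos.
          -- apply is_derive_PSeries; auto.
      + intros; apply Rmult_comm.
    - unfold plus, mult, scal, zero; simpl; unfold mult; simpl.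
      set (E := exp _).
      replace (PSeries (PS_derive g) t)
        with (p * (PSeries (PS_derive f) t * PSeries g t) / PSeries f t)
        by (rewrite <- ode; field; lra).
      field. lra. }
  assert (e : phi s = 1).
  { assert (e0 : phi 0 = 1).
    { unfold phi. rewrite !PSeries_0, f0. unfold Rpower. rewrite ln_1.
      replace (- p * 0) with 0 by ring. rewrite exp_0.
      unfold g, pow_coef. simpl. ring. }
    rewrite <- e0. destruct (Rtotal_order s 0) as [h|[h|h]].
    - apply (eq_is_derive phi); [|exact h]. intros t ht. apply dphi.
      rewrite !Rabs_left1 by lra. lra.
    - now rewrite h.
    - symmetry. apply (eq_is_derive phi); [|exact h]. intros t ht. apply dphi.
      rewrite !Rabs_pos_eq by lra. lra. }
  unfold phi in e. rewrite Rpower_Ropp in e.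
  assert (hP : 0 < Rpower (PSeries f s) p) by apply exp_pos.
  apply Rmult_eq_reg_r with (/ Rpower (PSeries f s) p).
  - rewrite e. field. lra.
  - apply Rgt_not_eq, Rinv_0_lt_compat, hP.
Qed.

(* [D] is the parameter set on which the estimates are uniform. *)
Definition uanalytic {T : Type} (D : T -> Prop) (F : R -> T -> R) : Prop :=
  exists r B : R, 0 < r /\ 0 <= B /\
    forall w : T, D w -> exists a : nat -> R, geometric r B a /\
      forall s : R, Rabs s * r < 1 -> F s w = PSeries a s.

Lemma uanalytic_ext_near {T : Type} (D : T -> Prop) (F G : R -> T -> R) (d : R) :
  0 < d -> (forall s w, Rabs s < d -> D w -> F s w = G s w) ->
  uanalytic D F -> uanalytic D G.
Proof.
  intros hd hFG (r & B & hr & hB & H).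
  assert (hd' : 0 < / d) by now apply Rinv_0_lt_compat.
  (* Adding [/ d] to the rate confines [s] to [Rabs s < d], where [F] and [G] agree. *)
  exists (r + / d), B. split; [lra | split; [exact hB|]].
  intros w hw. destruct (H w hw) as (a & ha & Ha). exists a. split.
  - apply (geometric_weaken r B); [lra | lra | exact ha].
  - intros s hs. pose proof (Rabs_pos s).
    rewrite <- hFG; [apply Ha; nra | | exact hw].
    assert (Rabs s * / d < 1) by nra.
    apply Rmult_lt_reg_r with (/ d); [exact hd'|]. rewrite Rinv_r by lra. lra.
Qed.

Lemma uanalytic_ext {T : Type} (D : T -> Prop) (F G : R -> T -> R) :
  (forall s w, F s w = G s w) -> uanalytic D F -> uanalytic D G.
Proof.
  intros e. apply (uanalytic_ext_near D F G 1); [lra | auto].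
Qed.

Definition const_coef (c : R) (n : nat) : R := match n with O => c | S _ => 0 end.

Lemma geometric_const_coef (c : R) : geometric 1 (Rabs c) (const_coef c).
Proof.
  intros n. rewrite pow1, Rmult_1_r.
  destruct n; simpl; [lra | rewrite Rabs_R0; apply Rabs_pos].
Qed.

Lemma PSeries_const_coef (c s : R) : Rabs s * 1 < 1 -> PSeries (const_coef c) s = c.
Proof.
  intros hs. rewrite PSeries_decr_1.
  - unfold PS_decr_1. simpl. rewrite PSeries_const_0. ring.
  - apply CV_radius_inside, (geometric_radius 1 (Rabs c)); [lra | | exact hs].
    apply geometric_const_coef.
Qed.

Lemma uanalytic_const {T : Type} (D : T -> Prop) (g : T -> R) (C : R) :
  (forall w, D w -> Rabs (g w) <= C) -> uanalytic D (fun _ w => g w).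
Proof.
  (* [C] may be negative when [D] is empty, hence [Rabs C]. *)
  intros hg. exists 1, (Rabs C). split; [lra | split; [apply Rabs_pos|]].
  intros w hw. exists (const_coef (g w)). split.
  - apply (geometric_weaken 1 (Rabs (g w))); [lra | | apply geometric_const_coef].
    split; [apply Rabs_pos|]. pose proof (Rle_abs C). specialize (hg w hw). lra.
  - intros s hs. symmetry. now apply PSeries_const_coef.
Qed.

Lemma uanalytic_cst {T : Type} (D : T -> Prop) (c : R) : uanalytic D (fun _ _ => c).
Proof.
  apply (uanalytic_const D (fun _ => c) (Rabs c)). intros; lra.
Qed.

Lemma uanalytic_var {T : Type} (D : T -> Prop) : uanalytic D (fun s _ => s).
Proof.
  exists 1, 1. split; [lra | split; [lra|]]. intros w hw.
  exists (PS_incr_1 (const_coef 1)). split.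
  - intros [|n]; simpl.
    + change (@zero R_NormedModule) with 0. rewrite Rabs_R0. lra.
    + rewrite pow1. pose proof (geometric_const_coef 1 n) as h.
      rewrite pow1, Rabs_R1 in h. lra.
  - intros s hs. rewrite PSeries_incr_1, PSeries_const_coef by exact hs. ring.
Qed.

Lemma uanalytic_plus {T : Type} (D : T -> Prop) (F G : R -> T -> R) :
  uanalytic D F -> uanalytic D G -> uanalytic D (fun s w => F s w + G s w).
Proof.
  intros (r & B & hr & hB & HF) (r' & B' & hr' & hB' & HG).
  exists (r + r'), (B + B'). split; [lra | split; [lra|]].
  intros w hw. destruct (HF w hw) as (a & ha & Ha). destruct (HG w hw) as (b & hb & Hb).
  exists (PS_plus a b). split.
  - apply geometric_plus;
      [apply (geometric_weaken r B) | apply (geometric_weaken r' B')]; trivial; lra.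
  - intros s hs. pose proof (Rabs_pos s).
    assert (Rabs s * r < 1) by nra. assert (Rabs s * r' < 1) by nra.
    rewrite Ha, Hb by lra. symmetry. apply PSeries_plus.
    + apply CV_radius_inside, (geometric_radius r B); trivial.
    + apply CV_radius_inside, (geometric_radius r' B'); trivial.
Qed.

Lemma uanalytic_mult {T : Type} (D : T -> Prop) (F G : R -> T -> R) :
  uanalytic D F -> uanalytic D G -> uanalytic D (fun s w => F s w * G s w).
Proof.
  intros (r & B & hr & hB & HF) (r' & B' & hr' & hB' & HG).
  exists (2 * (r + r')), (B * B'). split; [lra | split; [nra|]].
  intros w hw. destruct (HF w hw) as (a & ha & Ha). destruct (HG w hw) as (b & hb & Hb).
  exists (PS_mult a b). split.
  - apply geometric_mult; [lra | |];
      [apply (geometric_weaken r B) | apply (geometric_weaken r' B')]; trivial; lra.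
  - intros s hs. pose proof (Rabs_pos s).
    assert (Rabs s * r < 1) by nra. assert (Rabs s * r' < 1) by nra.
    rewrite Ha, Hb by lra. symmetry. apply PSeries_mult.
    + apply (geometric_radius r B); trivial.
    + apply (geometric_radius r' B'); trivial.
Qed.

Lemma uanalytic_opp {T : Type} (D : T -> Prop) (F : R -> T -> R) :
  uanalytic D F -> uanalytic D (fun s w => - F s w).
Proof.
  intros hF. apply (uanalytic_ext D (fun s w => (-1) * F s w)); [intros; ring|].
  apply uanalytic_mult; [apply uanalytic_cst | exact hF].
Qed.

Lemma uanalytic_minus {T : Type} (D : T -> Prop) (F G : R -> T -> R) :
  uanalytic D F -> uanalytic D G -> uanalytic D (fun s w => F s w - G s w).
Proof.
  intros hF hG. apply uanalytic_plus; [exact hF | now apply uanalytic_opp].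
Qed.

Lemma uanalytic_pow {T : Type} (D : T -> Prop) (F : R -> T -> R) (n : nat) :
  uanalytic D F -> uanalytic D (fun s w => F s w ^ n).
Proof.
  intros hF. induction n as [|n IH]; [exact (uanalytic_cst D 1)|].
  now apply uanalytic_mult.
Qed.

Lemma uanalytic_near {T : Type} (D : T -> Prop) (F : R -> T -> R) (e : R) :
  0 < e -> uanalytic D F ->
  exists d : R, 0 < d /\
    forall s w, Rabs s < d -> D w -> Rabs (F s w - F 0 w) < e.
Proof.
  intros he (r & B & hr & hB & H).
  (* [Rabs s * k < 1] yields both [Rabs s * r <= 1 / 2] and [2 * B * r * Rabs s < e]. *)
  set (k := 2 * r + 2 * B * r / e).
  assert (hk : 2 * r <= k).
  { unfold k. assert (0 <= 2 * B * r / e); [|lra].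
    apply Rmult_le_pos; [nra | left; now apply Rinv_0_lt_compat]. }
  exists (/ k). split; [apply Rinv_0_lt_compat; lra|].
  intros s w hs hw. destruct (H w hw) as (a & ha & Ha).
  pose proof (Rabs_pos s) as hs0.
  assert (hsk : Rabs s * k < 1).
  { apply Rmult_lt_reg_r with (/ k); [apply Rinv_0_lt_compat; lra|].
    rewrite Rmult_assoc, Rinv_r by lra. lra. }
  assert (h2 : Rabs s * r <= 1 / 2) by nra.
  rewrite (Ha s) by lra. rewrite (Ha 0) by (rewrite Rabs_R0; lra).
  rewrite PSeries_0.
  eapply Rle_lt_trans; [apply (geometric_PSeries_near r B); trivial|].
  assert (e2 : k * e = 2 * r * e + 2 * B * r) by (unfold k; field; lra).
  assert (Rabs s * k * e < 1 * e) by (apply Rmult_lt_compat_r; lra).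
  assert (0 <= Rabs s * r * e) by (apply Rmult_le_pos; nra).
  nra.
Qed.

Lemma uanalytic_pos {T : Type} (D : T -> Prop) (F : R -> T -> R) (c : R) :
  0 < c -> (forall w, D w -> F 0 w = c) -> uanalytic D F ->
  exists d : R, 0 < d /\ forall s w, Rabs s < d -> D w -> 0 < F s w.
Proof.
  intros hc h0 hF. destruct (uanalytic_near D F c hc hF) as (d & hd & H).
  exists d. split; [exact hd|]. intros s w hs hw. specialize (H s w hs hw).
  rewrite (h0 w hw) in H. apply Rabs_lt_between in H. lra.
Qed.

(** The value [c] at 0 is common to all parameters, so [F] is positive on a common interval, and
    [/ c * F] starts at 1 as [PSeries_pow_coef] requires. Inverses, square roots and the cube root
    in [side] are instances. *)
Lemma uanalytic_Rpower {T : Type} (D : T -> Prop) (F : R -> T -> R) (p c : R) :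
  Rabs p <= 1 -> 0 < c -> (forall w, D w -> F 0 w = c) -> uanalytic D F ->
  uanalytic D (fun s w => Rpower (F s w) p).
Proof.
  intros hp hc h0 hF.
  assert (hG : uanalytic D (fun s w => / c * F s w))
    by (apply uanalytic_mult; [apply uanalytic_cst | exact hF]).
  destruct (uanalytic_pos D F c hc h0 hF) as (d & hd & hpos).
  apply (uanalytic_ext_near D (fun s w => Rpower c p * Rpower (/ c * F s w) p) _ d hd).
  { intros s w hs hw. rewrite <- Rpower_mult_distr; trivial.
    - unfold Rpower. rewrite <- Rmult_assoc, <- !exp_plus. f_equal.
      rewrite ln_Rinv by exact hc. ring.
    - now apply Rinv_0_lt_compat.
    - now apply hpos. }
  apply uanalytic_mult; [apply uanalytic_cst|].
  destruct hG as (r & B & hr & hB & H).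
  exists (2 * (1 + B) * r), 1. split; [nra | split; [lra|]].
  intros w hw. destruct (H w hw) as (a & ha & Ha).
  exists (pow_coef p a). split.
  - apply (geometric_weaken ((1 + B) * r) 1); [nra | lra | now apply geometric_pow_coef].
  - intros s hs. pose proof (Rabs_pos s).
    assert (0 <= Rabs s * r) by nra. assert (0 <= Rabs s * r * B) by nra.
    rewrite Ha by nra. symmetry. apply (PSeries_pow_coef p r B); trivial.
    rewrite <- PSeries_0, <- Ha by (rewrite Rabs_R0; lra).
    rewrite h0 by exact hw. now apply Rinv_l, Rgt_not_eq.
Qed.

Lemma uanalytic_inv {T : Type} (D : T -> Prop) (F : R -> T -> R) (c : R) :
  0 < c -> (forall w, D w -> F 0 w = c) -> uanalytic D F ->
  uanalytic D (fun s w => / F s w).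
Proof.
  intros hc h0 hF. destruct (uanalytic_pos D F c hc h0 hF) as (d & hd & hpos).
  apply (uanalytic_ext_near D (fun s w => Rpower (F s w) (- (1))) _ d hd).
  - intros s w hs hw. rewrite Rpower_Ropp, Rpower_1; auto.
  - apply (uanalytic_Rpower D F _ c); trivial. apply Rabs_le. lra.
Qed.

Lemma uanalytic_sqrt {T : Type} (D : T -> Prop) (F : R -> T -> R) (c : R) :
  0 < c -> (forall w, D w -> F 0 w = c) -> uanalytic D F ->
  uanalytic D (fun s w => sqrt (F s w)).
Proof.
  intros hc h0 hF. destruct (uanalytic_pos D F c hc h0 hF) as (d & hd & hpos).
  apply (uanalytic_ext_near D (fun s w => Rpower (F s w) (/ 2)) _ d hd).
  - intros s w hs hw. apply Rpower_sqrt; auto.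
  - apply (uanalytic_Rpower D F _ c); trivial. apply Rabs_le. lra.
Qed.

(** Derivatives at 0 do not depend on [D], so one sequence of coefficients serves all neighbourhoods
    and can be chosen before the point. *)
Definition taylor {T : Type} (F : R -> T -> R) (n : nat) (w : T) : R :=
  Derive_n (fun s => F s w) n 0 / INR (fact n).

(** The sum near 0 determines the coefficients of a power series. Staying within half of the radius
    [/ r] gives the uniform bound [2 * B]. *)
Lemma uanalytic_taylor {T : Type} (D : T -> Prop) (F : R -> T -> R) :
  uanalytic D F ->
  exists d M : R, 0 < d /\ forall s w, Rabs s < d -> D w ->
    is_pseries (fun n => taylor F n w) s (F s w) /\ Rabs (F s w) <= M.
Proof.
  intros (r & B & hr & hB & H).
  exists (/ (2 * r)), (2 * B). split; [apply Rinv_0_lt_compat; lra|].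
  intros s w hs hw. destruct (H w hw) as (a & ha & Ha).
  assert (hsr : Rabs s * r <= 1 / 2).
  { apply Rmult_lt_compat_r with (r := 2 * r) in hs; [|lra].
    rewrite Rinv_l in hs by lra. lra. }
  assert (hrad : forall t, Rabs t * r < 1 -> Rbar_lt (Rabs t) (CV_radius a))
    by (intros t ht; now apply (geometric_radius r B)).
  rewrite Ha by lra. split.
  - apply is_pseries_ext with a.
    + intros n. change (a n = taylor F n w :> R). unfold taylor.
      rewrite (Derive_n_ext_loc _ (PSeries a)).
      * rewrite Derive_n_coef.
        -- field. apply INR_fact_neq_0.
        -- rewrite <- Rabs_R0. apply hrad. rewrite Rabs_R0. lra.
      * assert (hr' : 0 < / r) by now apply Rinv_0_lt_compat.
        exists (mkposreal _ hr'). intros t ht. apply Ha.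
        change (Rabs (t - 0) < / r) in ht. rewrite Rminus_0_r in ht.
        apply Rmult_lt_reg_r with (/ r); [exact hr'|].
        rewrite Rmult_assoc, Rinv_r by lra. lra.
    + apply PSeries_correct, CV_radius_inside, hrad. lra.
  - now apply (geometric_PSeries_bound r B).
Qed.

(** * The expansion at the tertiary *)

(** With [h = 1 - u / 2 + 3 / 8 * u ^ 2] and [r = / sqrt (1 + u)], this is
    [(h ^ 2 - r ^ 2) / (u ^ 3 * (h + r))] after cancelling [u ^ 3], since [h ^ 2 * (1 + u) = 1 + u ^
    3 * (5 / 8 - 15 / 64 * u + 9 / 64 * u ^ 2)]. This closed form is regular at [u = 0]. *)
Definition cubic_remainder (u : R) : R :=
  (5 / 8 - 15 / 64 * u + 9 / 64 * u ^ 2)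
  * / ((1 + u) * (/ sqrt (1 + u) + (1 - u / 2 + 3 / 8 * u ^ 2))).

Lemma inv_sqrt_expansion (u : R) :
  0 < 1 + u ->
  / sqrt (1 + u) = 1 - u / 2 + 3 / 8 * u ^ 2 - u ^ 3 * cubic_remainder u.
Proof.
  intros hu. unfold cubic_remainder.
  assert (hr : 0 < / sqrt (1 + u)) by now apply Rinv_0_lt_compat, sqrt_lt_R0.
  assert (e : (/ sqrt (1 + u)) ^ 2 * (1 + u) = 1).
  { rewrite pow_inv, pow2_sqrt by lra. field. lra. }
  set (r := / sqrt (1 + u)) in *. set (h := 1 - u / 2 + 3 / 8 * u ^ 2).
  (* [h = 3 / 8 * (u - 2 / 3) ^ 2 + 5 / 6]. *)
  assert (hh : 0 < h) by (unfold h; pose proof (pow2_ge_0 (u - 2 / 3)); nra).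
  apply Rmult_eq_reg_r with ((1 + u) * (r + h)); [|nra].
  transitivity (h * ((1 + u) * (r + h)) - u ^ 3 * (5 / 8 - 15 / 64 * u + 9 / 64 * u ^ 2)).
  - replace (r * ((1 + u) * (r + h))) with (r ^ 2 * (1 + u) + r * h * (1 + u)) by ring.
    rewrite e. unfold h. field.
  - field. split; lra.
Qed.

(** The bound by 1 makes [4 - v ^ 2] positive, so that its square root squares back. *)
Lemma side_pow3 (R3 C20 : R) : C20 < 0 ->
  0 < side R3 C20 <= 1 /\ side R3 C20 ^ 3 = / (1 - 3 / 2 * R3 ^ 2 * C20)
  /\ 1 / omega R3 C20 ^ 2 = side R3 C20 ^ 3.
Proof.
  intros hC. pose proof (pow2_ge_0 R3).
  assert (hom : 1 <= 1 - 3 / 2 * R3 ^ 2 * C20) by nra.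
  assert (hv : 0 < side R3 C20) by apply exp_pos.
  assert (e : side R3 C20 ^ 3 = / (1 - 3 / 2 * R3 ^ 2 * C20)).
  { unfold side. rewrite <- Rpower_pow by apply exp_pos.
    rewrite Rpower_mult. replace (1 / 3 * INR 3) with 1 by (simpl; field).
    unfold Rdiv. rewrite Rmult_1_l. apply Rpower_1, Rinv_0_lt_compat. lra. }
  assert (h1 : side R3 C20 ^ 3 <= 1).
  { rewrite e, <- Rinv_1. apply Rinv_le_contravar; lra. }
  repeat split.
  - exact hv.
  - apply Rnot_lt_le. intros h. simpl in h1. nra.
  - exact e.
  - rewrite e. unfold omega. rewrite pow2_sqrt by lra. field. lra.
Qed.

Lemma posS_pos (v m2 m3 : R) : 0 <= m2 -> 0 < m3 ->
  0 < posS v m2 m3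
  /\ posS v m2 m3 ^ 2 = v ^ 2 * m2 ^ 2 + v ^ 2 * m2 * m3 + m3 ^ 2.
Proof.
  intros h2 h3.
  assert (h : 0 < v ^ 2 * m2 ^ 2 + v ^ 2 * m2 * m3 + m3 ^ 2).
  { pose proof (pow2_ge_0 v). pose proof (pow2_ge_0 m2).
    assert (0 <= v ^ 2 * m2 ^ 2) by nra.
    assert (0 <= v ^ 2 * m2 * m3) by (apply Rmult_le_pos; nra). nra. }
  unfold posS. split; [now apply sqrt_lt_R0 | apply pow2_sqrt; lra].
Qed.

(* With [d_i] the vector from the body [i] to the tertiary, [along1] and [along2]
   are [d_i . (x, y)]. *)
Definition along1 (v m2 m3 x y : R) : R :=
  (x3 v m2 m3 - x1 v m2 m3) * x + (y3 v m2 m3 - y1) * y.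
Definition along2 (v m2 m3 x y : R) : R :=
  (x3 v m2 m3 - x2 v m2 m3) * x + (y3 v m2 m3 - y2 v m2 m3) * y.

Lemma sides_unit (v m2 m3 : R) : 0 <= m2 -> 0 < m3 -> 0 < v <= 1 ->
  (x3 v m2 m3 - x1 v m2 m3) ^ 2 + (y3 v m2 m3 - y1) ^ 2 = 1 /\
  (x3 v m2 m3 - x2 v m2 m3) ^ 2 + (y3 v m2 m3 - y2 v m2 m3) ^ 2 = 1.
Proof.
  intros h2 h3 hv. destruct (posS_pos v m2 m3 h2 h3) as [hS eS].
  assert (eg : sqrt (4 - v ^ 2) ^ 2 = 4 - v ^ 2) by (apply pow2_sqrt; nra).
  unfold x1, x2, x3, y1, y2, y3.
  set (S := posS v m2 m3) in *. set (g := sqrt (4 - v ^ 2)) in *.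
  split; apply Rmult_eq_reg_r with (4 * S ^ 2); try nra.
  - transitivity ((v ^ 2 * m2 + 2 * m3) ^ 2 + v ^ 2 * m2 ^ 2 * g ^ 2); [field; lra|].
    rewrite eg, eS. ring.
  - transitivity ((2 * m3 - v ^ 2 * m2 - v ^ 2 * m3) ^ 2
                  + v ^ 2 * (m2 + m3) ^ 2 * g ^ 2); [field; lra|].
    rewrite eg, eS. ring.
Qed.

(** The masses have sum 1 and center of mass at the origin, so the weighted sum of the vectors [d_i]
    is the position of the tertiary. Thus the linear part of the attraction balances the centrifugal
    term up to the factor [v ^ 3]. *)
Lemma center_of_mass (v m1 m2 m3 x y : R) :
  0 <= m2 -> 0 < m3 -> m1 + m2 + m3 = 1 ->
  m1 * along1 v m2 m3 x y + m2 * along2 v m2 m3 x y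
  = x3 v m2 m3 * x + y3 v m2 m3 * y.
Proof.
  intros h2 h3 h1. destruct (posS_pos v m2 m3 h2 h3) as [hS eS].
  replace m1 with (1 - m2 - m3) by lra.
  unfold along1, along2, x1, x2, x3, y1, y2, y3.
  set (S := posS v m2 m3) in *. set (g := sqrt (4 - v ^ 2)) in *.
  apply Rmult_eq_reg_r with (2 * S); [|lra].
  apply Rminus_diag_uniq.
  (* The [y] components cancel identically; the [x] components need the value of [S ^ 2]. *)
  transitivity (2 * x * (S ^ 2 - (v ^ 2 * m2 ^ 2 + v ^ 2 * m2 * m3 + m3 ^ 2))).
  - field. lra.
  - rewrite eS. ring.
Qed.

(** The deviation of the square of [along1] from its limit at [m3 = 0], already divided by [m3]: the
    factor is cancelled by hand, so the formula stays regular in the limit. *)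
Definition along1_defect (v m2 m3 x y : R) : R :=
  ((4 * v ^ 2 * m2 + 4 * m3 - v ^ 4 * m2 - v ^ 2 * m3) * (x ^ 2 - y ^ 2)
   + 2 * v * sqrt (4 - v ^ 2) * (2 * m2 - v ^ 2 * m2 - m3) * (x * y))
  * / (4 * posS v m2 m3 ^ 2).
Definition along2_defect (v m2 m3 x y : R) : R :=
  ((v ^ 4 * (m2 + m3) - 4 * v ^ 2 * (m2 + m3) + 4 * m3 - v ^ 2 * m3)
   * (x ^ 2 - y ^ 2)
   + 2 * v * sqrt (4 - v ^ 2) * (2 * m2 + 3 * m3 - v ^ 2 * (m2 + m3)) * (x * y))
  * / (4 * posS v m2 m3 ^ 2).

(** As [m3] tends to 0 with [v] and [m2 > 0] fixed, [S] tends to [v * m2], and the vectors [d_1],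
    [d_2] tend to [(v / 2, g / 2)], [(- v / 2, g / 2)] with [g = sqrt (4 - v ^ 2)]. *)
Lemma along_sqr (v m2 m3 x y : R) : 0 <= m2 -> 0 < m3 -> 0 < v <= 1 ->
  along1 v m2 m3 x y ^ 2
  = (v / 2 * x + sqrt (4 - v ^ 2) / 2 * y) ^ 2 + m3 * along1_defect v m2 m3 x y /\
  along2 v m2 m3 x y ^ 2
  = (- v / 2 * x + sqrt (4 - v ^ 2) / 2 * y) ^ 2 + m3 * along2_defect v m2 m3 x y.
Proof.
  intros h2 h3 hv. destruct (posS_pos v m2 m3 h2 h3) as [hS eS].
  assert (eg : sqrt (4 - v ^ 2) ^ 2 = 4 - v ^ 2) by (apply pow2_sqrt; nra).
  unfold along1, along2, along1_defect, along2_defect, x1, x2, x3, y1, y2, y3.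
  set (S := posS v m2 m3) in *. set (g := sqrt (4 - v ^ 2)) in *.
  assert (eg' : g ^ 2 - (4 - v ^ 2) = 0) by lra.
  assert (eS' : S ^ 2 - (v ^ 2 * m2 ^ 2 + v ^ 2 * m2 * m3 + m3 ^ 2) = 0) by lra.
  split; apply Rmult_eq_reg_r with (4 * S ^ 2); try nra.
  - transitivity (((v ^ 2 * m2 + 2 * m3) * x + v * g * m2 * y) ^ 2); [field; lra|].
    transitivity ((v * x + g * y) ^ 2 * S ^ 2
      + m3 * ((4 * v ^ 2 * m2 + 4 * m3 - v ^ 4 * m2 - v ^ 2 * m3) * (x ^ 2 - y ^ 2)
      + 2 * v * g * (2 * m2 - v ^ 2 * m2 - m3) * (x * y))); [|field; lra].
    rewrite eS.
    replace ((v * x + g * y) ^ 2)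
      with (v ^ 2 * x ^ 2 + 2 * v * g * x * y + g ^ 2 * y ^ 2) by ring.
    replace (((v ^ 2 * m2 + 2 * m3) * x + v * g * m2 * y) ^ 2)
      with ((v ^ 2 * m2 + 2 * m3) ^ 2 * x ^ 2
            + 2 * (v ^ 2 * m2 + 2 * m3) * (v * g * m2) * x * y
            + v ^ 2 * m2 ^ 2 * g ^ 2 * y ^ 2) by ring.
    rewrite eg. ring.
  - transitivity (((2 * m3 - v ^ 2 * m2 - v ^ 2 * m3) * x + v * g * (m2 + m3) * y) ^ 2);
      [field; lra|].
    transitivity ((- v * x + g * y) ^ 2 * S ^ 2
      + m3 * ((v ^ 4 * (m2 + m3) - 4 * v ^ 2 * (m2 + m3) + 4 * m3 - v ^ 2 * m3)
              * (x ^ 2 - y ^ 2)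
      + 2 * v * g * (2 * m2 + 3 * m3 - v ^ 2 * (m2 + m3)) * (x * y))); [|field; lra].
    rewrite eS.
    replace ((- v * x + g * y) ^ 2)
      with (v ^ 2 * x ^ 2 - 2 * v * g * x * y + g ^ 2 * y ^ 2) by ring.
    replace (((2 * m3 - v ^ 2 * m2 - v ^ 2 * m3) * x + v * g * (m2 + m3) * y) ^ 2)
      with ((2 * m3 - v ^ 2 * m2 - v ^ 2 * m3) ^ 2 * x ^ 2
            + 2 * (2 * m3 - v ^ 2 * m2 - v ^ 2 * m3) * (v * g * (m2 + m3)) * x * y
            + v ^ 2 * (m2 + m3) ^ 2 * g ^ 2 * y ^ 2) by ring.
    rewrite eg. ring.
Qed.

Lemma dist_to_shifted (a b c d s x y z : R) :
  (a - c) ^ 2 + (b - d) ^ 2 = 1 ->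
  dist_to c d (s * x + a) (s * y + b) (s * z)
  = sqrt (1 + s * (2 * ((a - c) * x + (b - d) * y) + s * (x ^ 2 + y ^ 2 + z ^ 2))).
Proof.
  intros h. unfold dist_to. f_equal. rewrite <- h at 1. ring.
Qed.

Lemma dist_to_center (a b s x y z : R) : 0 < s ->
  dist_to a b (s * x + a) (s * y + b) (s * z) = s * sqrt (x ^ 2 + y ^ 2 + z ^ 2).
Proof.
  intros hs. unfold dist_to.
  replace ((s * x + a - a) ^ 2 + (s * y + b - b) ^ 2 + (s * z) ^ 2)
    with (s ^ 2 * (x ^ 2 + y ^ 2 + z ^ 2)) by ring.
  rewrite sqrt_mult_alt by apply pow2_ge_0. now rewrite sqrt_pow2 by lra.
Qed.

(* [r_i ^ 2 = 1 + s * stretch s e_i q], where [e_i] is [along_i] and [q] the squared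
   distance to the tertiary, in the scaled coordinates. *)
Definition stretch (s e q : R) : R := 2 * e + s * q.

(* The quotient by [s] of the terms that the Hill limit neglects; the equality
   [1 - v ^ 3 = s ^ 2 * k] defines [k]. *)
Definition neglected_terms (mu rho3 C20 s x y z : R) : R :=
  let v := side (s * rho3) C20 in
  let k := - (3 / 2 * rho3 ^ 2 * C20) * / (1 - 3 / 2 * (s * rho3) ^ 2 * C20) in
  let m3 := s ^ 3 in
  let m2 := mu * (1 - s ^ 3) in
  let m1 := (1 - mu) * (1 - s ^ 3) in
  let e1 := along1 v m2 m3 x y in
  let e2 := along2 v m2 m3 x y in
  let q := x ^ 2 + y ^ 2 + z ^ 2 in
  let r := / sqrt q in
  let t1 := stretch s e1 q in
  let t2 := stretch s e2 q in
  - k * (x3 v m2 m3 * x + y3 v m2 m3 * y)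
  - s * k * ((1 - s ^ 3) * q * / 2 - 3 / 2 * (m1 * e1 ^ 2 + m2 * e2 ^ 2))
  - s ^ 2 * q * / 2
  - 3 / 2 * s ^ 2 * ((1 - mu) * along1_defect v m2 m3 x y
                     + mu * along2_defect v m2 m3 x y
                     - ((1 - mu) * e1 ^ 2 + mu * e2 ^ 2))
  - v ^ 3 * (3 / 2 * q * (m1 * e1 + m2 * e2) + 3 / 8 * s * (1 - s ^ 3) * q ^ 2)
  + v ^ 3 * (m1 * t1 ^ 3 * cubic_remainder (s * t1)
             + m2 * t2 ^ 3 * cubic_remainder (s * t2))
  + s * k * (r + rho3 ^ 2 * C20 / 2 * r ^ 3 * (3 * z ^ 2 * r ^ 2 - 1)).

(** The first summand is left by the shift of positions and momenta, whose terms linear in the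
    momenta cancel; the second is the potential of the two other bodies at the tertiary, at distance
    1 from both. It is independent of the phase point, so removing it preserves Hamilton's
    equations. *)
Definition hill_constant (mu rho3 C20 m3 : R) : R :=
  let s := Rpower m3 (1 / 3) in
  let v := side (s * rho3) C20 in
  let m2 := mu * (1 - m3) in
  - (1 / 2 * (x3 v m2 m3 ^ 2 + y3 v m2 m3 ^ 2) + v ^ 3 * (1 - m3)) / s ^ 2.

(** No limit is taken: the identity is algebraic once the inverse distances are expanded with their
    explicit remainder. The last two hypotheses exclude collisions with the primary and the
    secondary. *)
Lemma hill_remainder (mu rho3 C20 s x y z px py pz : R) :
  let v := side (s * rho3) C20 in
  let m3 := s ^ 3 in
  let m2 := mu * (1 - s ^ 3) in
  let m1 := (1 - mu) * (1 - s ^ 3) in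
  let q := x ^ 2 + y ^ 2 + z ^ 2 in
  0 < mu -> C20 < 0 -> 0 < s < 1 -> 0 < q ->
  0 < 1 + s * stretch s (along1 v m2 m3 x y) q ->
  0 < 1 + s * stretch s (along2 v m2 m3 x y) q ->
  / s ^ 2 * H4body m1 m2 m3 (s * rho3) C20
              (shift (x3 v m2 m3) (y3 v m2 m3) (scaling s (x, y, z, px, py, pz)))
  - - (1 / 2 * (x3 v m2 m3 ^ 2 + y3 v m2 m3 ^ 2) + v ^ 3 * (1 - m3)) / s ^ 2
  - Hhill_rho mu v rho3 C20 (x, y, z, px, py, pz)
  = s * neglected_terms mu rho3 C20 s x y z.
Proof.
  intros v m3 m2 m1 q hmu hC hs hq hu1 hu2.
  destruct (side_pow3 (s * rho3) C20 hC) as (hv & ev & ew). fold v in hv, ev, ew.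
  assert (hs3 : 0 < s ^ 3 < 1) by (split; [apply pow_lt; lra | simpl; nra]).
  assert (h3 : 0 < m3) by (unfold m3; lra).
  assert (h2 : 0 <= m2) by (unfold m2; nra).
  destruct (sides_unit v m2 m3 h2 h3 hv) as [u1 u2].
  destruct (along_sqr v m2 m3 x y h2 h3 hv) as [a1 a2].
  assert (com : m1 * along1 v m2 m3 x y + m2 * along2 v m2 m3 x y
                = x3 v m2 m3 * x + y3 v m2 m3 * y)
    by (apply center_of_mass; trivial; unfold m1, m2, m3; ring).
  unfold H4body, shift, scaling, Hhill_rho, quadratic_part. fold v.
  rewrite ew, dist_to_center, !dist_to_shifted by (trivial; lra).
  fold q.
  change (2 * ((x3 v m2 m3 - x1 v m2 m3) * x + (y3 v m2 m3 - y1) * y) + s * q)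
    with (stretch s (along1 v m2 m3 x y) q).
  change (2 * ((x3 v m2 m3 - x2 v m2 m3) * x + (y3 v m2 m3 - y2 v m2 m3) * y) + s * q)
    with (stretch s (along2 v m2 m3 x y) q).
  unfold neglected_terms. cbv zeta. fold v m2 m1 m3 q.
  pose proof (inv_sqrt_expansion _ hu1) as i1.
  pose proof (inv_sqrt_expansion _ hu2) as i2.
  set (r1 := sqrt (1 + s * stretch s (along1 v m2 m3 x y) q)) in *.
  set (r2 := sqrt (1 + s * stretch s (along2 v m2 m3 x y) q)) in *.
  set (c1 := cubic_remainder (s * stretch s (along1 v m2 m3 x y) q)) in i1 |- *.
  set (c2 := cubic_remainder (s * stretch s (along2 v m2 m3 x y) q)) in i2 |- *.
  assert (hr : 0 < sqrt q) by now apply sqrt_lt_R0.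
  assert (er : q = sqrt q ^ 2) by (symmetry; apply pow2_sqrt; lra).
  assert (eg : sqrt (4 - v ^ 2) ^ 2 = 4 - v ^ 2) by (apply pow2_sqrt; nra).
  set (r := sqrt q) in *. set (g := sqrt (4 - v ^ 2)) in *.
  set (e1 := along1 v m2 m3 x y) in *. set (e2 := along2 v m2 m3 x y) in *.
  set (f1 := along1_defect v m2 m3 x y) in *. set (f2 := along2_defect v m2 m3 x y) in *.
  set (X := x3 v m2 m3) in *. set (Y := y3 v m2 m3) in *.
  assert (hom : 0 < 1 - 3 / 2 * (s * rho3) ^ 2 * C20)
    by (pose proof (pow2_ge_0 (s * rho3)); nra).
  set (k := - (3 / 2 * rho3 ^ 2 * C20) * / (1 - 3 / 2 * (s * rho3) ^ 2 * C20)).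
  assert (ek : v ^ 3 = 1 - s ^ 2 * k) by (rewrite ev; unfold k; field; lra).
  clearbody k. clear ev ew hom u1 u2.
  replace (m1 / r1) with (m1 * / r1) by reflexivity.
  replace (m2 / r2) with (m2 * / r2) by reflexivity.
  rewrite i1, i2. clear i1 i2 r1 r2 hu1 hu2.
  replace (3 * z ^ 2 / q) with (3 * z ^ 2 / r ^ 2) by now rewrite <- er.
  rewrite ek. clearbody r c1 c2 e1 e2 f1 f2 X Y g. clear er ek.
  apply Rminus_diag_uniq.
  (* The difference of the two sides is a combination of relations that vanish: the center of mass,
     the two formulas for the squares, and [g ^ 2 = 4 - v ^ 2]. *)
  transitivity (- (1 - s ^ 2 * k) / s * ((X * x + Y * y) - (m1 * e1 + m2 * e2))
    - 3 / 2 * ((1 - mu) * (e1 ^ 2 - ((v / 2 * x + g / 2 * y) ^ 2 + m3 * f1))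
               + mu * (e2 ^ 2 - ((- v / 2 * x + g / 2 * y) ^ 2 + m3 * f2)))
    + 3 / 8 * y ^ 2 * (4 - v ^ 2 - g ^ 2)).
  - unfold stretch, m1, m2, m3, q. clear - hs hr. field. lra.
  - rewrite com, a1, a2, eg. ring.
Qed.

(** * Analyticity of the neglected terms *)

Definition posx (w : phase) : R := let '(x, _, _, _, _, _) := w in x.
Definition posy (w : phase) : R := let '(_, y, _, _, _, _) := w in y.
Definition posz (w : phase) : R := let '(_, _, z, _, _, _) := w in z.

Definition norm2 (w : phase) : R := posx w ^ 2 + posy w ^ 2 + posz w ^ 2.

(** Positivity of [norm2] is stated apart because [/ sqrt 0 = 0] would satisfy the last bound. *)
Definition away (L : R) (w : phase) : Prop :=
  Rabs (posx w) <= L /\ Rabs (posy w) <= L /\ Rabs (posz w) <= L /\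
  0 < norm2 w /\ / sqrt (norm2 w) <= L.

Lemma locally_away (w0 : phase) :
  off_tertiary w0 -> exists L : R, locally w0 (away L).
Proof.
  destruct w0 as [[[[[x0 y0] z0] a0] b0] c0]. simpl. intros h0.
  assert (hn : 0 < x0 ^ 2 + y0 ^ 2 + z0 ^ 2).
  { destruct (Req_dec x0 0) as [hx|hx]; [|pose proof (pow2_gt_0 x0 hx); nra].
    destruct (Req_dec y0 0) as [hy|hy]; [|pose proof (pow2_gt_0 y0 hy); nra].
    destruct (Req_dec z0 0) as [hz|hz]; [|pose proof (pow2_gt_0 z0 hz); nra].
    exfalso. apply h0. now rewrite hx, hy, hz. }
  (* On the ball of radius [m / 2], a coordinate attaining the maximum [m] at [w0] stays at least
     [m / 2] in absolute value. *)
  set (m := Rmax (Rabs x0) (Rmax (Rabs y0) (Rabs z0))).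
  assert (hxm : Rabs x0 <= m) by apply Rmax_l.
  assert (hym : Rabs y0 <= m) by (eapply Rle_trans; [apply Rmax_l | apply Rmax_r]).
  assert (hzm : Rabs z0 <= m) by (eapply Rle_trans; [apply Rmax_r | apply Rmax_r]).
  assert (hm : 0 < m).
  { apply Rnot_le_lt. intros hm.
    assert (hz : forall t, Rabs t <= m -> t = 0).
    { intros t ht. apply Rabs_eq_0. pose proof (Rabs_pos t). lra. }
    rewrite (hz x0 hxm), (hz y0 hym), (hz z0 hzm) in hn. lra. }
  assert (hm2 : 0 < m / 2) by lra.
  (* [m + m / 2] bounds the coordinates and [/ (m / 2)] the inverse distance. *)
  exists (m + m / 2 + / (m / 2)).
  assert (hi : 0 < / (m / 2)) by now apply Rinv_0_lt_compat.
  exists (mkposreal _ hm2).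
  intros [[[[[x y] z] a] b] c] [[[[[hx hy] hz] _] _] _]. simpl in hx, hy, hz.
  assert (bd : forall t0 t, Rabs t0 <= m -> ball t0 (m / 2) t ->
               Rabs t <= m + m / 2 /\ (Rabs t0 = m -> (m / 2) ^ 2 <= t ^ 2)).
  { intros t0 t ht hb. change (Rabs (t - t0) < m / 2) in hb.
    pose proof (Rabs_triang_inv t t0). pose proof (Rabs_triang_inv t0 t).
    rewrite Rabs_minus_sym in H0. split; [lra|]. intros e.
    rewrite <- (pow2_abs t). apply pow_incr. lra. }
  destruct (bd _ _ hxm hx) as [bx qx]. destruct (bd _ _ hym hy) as [by_ qy].
  destruct (bd _ _ hzm hz) as [bz qz].
  unfold away, norm2; simpl posx; simpl posy; simpl posz.
  assert (hq : (m / 2) ^ 2 <= x ^ 2 + y ^ 2 + z ^ 2).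
  { pose proof (pow2_ge_0 x). pose proof (pow2_ge_0 y). pose proof (pow2_ge_0 z).
    assert (hc : Rabs x0 = m \/ Rabs y0 = m \/ Rabs z0 = m).
    { unfold m, Rmax. repeat destruct Rle_dec; auto. }
    destruct hc as [h|[h|h]];
      [specialize (qx h) | specialize (qy h) | specialize (qz h)]; lra. }
  assert (hp : 0 < (m / 2) ^ 2) by now apply pow_lt.
  repeat split; try lra.
  apply Rle_trans with (/ (m / 2)); [|lra].
  apply Rinv_le_contravar; [lra|].
  rewrite <- (sqrt_pow2 (m / 2)) by lra. now apply sqrt_le_1_alt.
Qed.

(** Non-constant inverses and roots have no rule, since they need a positive value at [s = 0]; they
    are supplied as hypotheses, which are tried first. *)
Ltac uanalytic_step :=
  match goal with
  | H : uanalytic _ _ |- uanalytic _ _ => exact H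
  | |- uanalytic _ (fun _ _ => ?c) => apply uanalytic_cst
  | |- uanalytic _ (fun s _ => s) => apply uanalytic_var
  | |- uanalytic ?D (fun s w => @?A s w + @?B s w) => apply (uanalytic_plus D A B)
  | |- uanalytic ?D (fun s w => @?A s w - @?B s w) => apply (uanalytic_minus D A B)
  | |- uanalytic ?D (fun s w => @?A s w * @?B s w) => apply (uanalytic_mult D A B)
  | |- uanalytic ?D (fun s w => @?A s w / ?c) =>
      apply (uanalytic_mult D A (fun _ _ => / c))
  | |- uanalytic ?D (fun s w => - @?A s w) => apply (uanalytic_opp D A)
  | |- uanalytic ?D (fun s w => @?A s w ^ ?n) => apply (uanalytic_pow D A n)
  end.
Ltac uanalytic := repeat uanalytic_step.

(** Applied to [stretch], this excludes collisions with the primary and the secondary for small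
    [s]. *)
Lemma uanalytic_one_plus {T : Type} (D : T -> Prop) (F : R -> T -> R) :
  uanalytic D F ->
  exists d : R, 0 < d /\ forall s w, Rabs s < d -> D w -> 0 < 1 + s * F s w.
Proof.
  intros hF. apply (uanalytic_pos D (fun s w => 1 + s * F s w) 1); [lra | |].
  - intros; ring.
  - uanalytic.
Qed.

Lemma uanalytic_cubic_remainder {T : Type} (D : T -> Prop) (F : R -> T -> R) :
  (forall w, D w -> F 0 w = 0) -> uanalytic D F ->
  uanalytic D (fun s w => cubic_remainder (F s w)).
Proof.
  intros h0 hF. unfold cubic_remainder.
  assert (hs : uanalytic D (fun s w => / sqrt (1 + F s w))).
  { apply (uanalytic_inv D _ 1); [lra | |].
    - intros w hw. rewrite h0 by exact hw. rewrite Rplus_0_r. apply sqrt_1.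
    - apply (uanalytic_sqrt D _ 1); [lra | |].
      + intros w hw. rewrite h0 by exact hw. ring.
      + uanalytic. }
  (* At [s = 0] the denominator is [1 * (1 + 1)]. *)
  uanalytic. apply (uanalytic_inv D _ 2); [lra | |].
  - intros w hw. rewrite h0 by exact hw.
    rewrite Rplus_0_r, sqrt_1, Rinv_1. field.
  - uanalytic.
Qed.

Lemma uanalytic_side (D : phase -> Prop) (rho3 C20 : R) :
  uanalytic D (fun s _ => / (1 - 3 / 2 * (s * rho3) ^ 2 * C20)) /\
  uanalytic D (fun s _ => side (s * rho3) C20).
Proof.
  assert (h : uanalytic D (fun s _ => / (1 - 3 / 2 * (s * rho3) ^ 2 * C20))).
  { apply (uanalytic_inv D _ 1); [lra | intros; ring | uanalytic]. }
  split; [exact h|]. unfold side.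
  apply (uanalytic_Rpower D (fun s _ => 1 / (1 - 3 / 2 * (s * rho3) ^ 2 * C20)) _ 1).
  - apply Rabs_le. lra.
  - lra.
  - intros w _. field.
  - apply (uanalytic_mult D (fun _ _ => 1)); uanalytic.
Qed.

Lemma side_0 (rho3 C20 : R) : side (0 * rho3) C20 = 1.
Proof.
  unfold side. replace (1 / (1 - 3 / 2 * (0 * rho3) ^ 2 * C20)) with 1 by field.
  unfold Rpower. rewrite ln_1, Rmult_0_r. apply exp_0.
Qed.

Lemma uanalytic_coordinates (L : R) :
  uanalytic (away L) (fun _ w => posx w) /\
  uanalytic (away L) (fun _ w => posy w) /\
  uanalytic (away L) (fun _ w => posz w).
Proof.
  repeat split; apply (uanalytic_const _ _ L); now intros w (h1 & h2 & h3 & _).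
Qed.

(** At [s = 0] the denominator [posS] is [sqrt (mu ^ 2) = mu], so [0 < mu] keeps it away from
    zero. *)
Lemma uanalytic_positions (D : phase -> Prop) (mu rho3 C20 : R) :
  0 < mu ->
  let v s := side (s * rho3) C20 in
  let m2 s := mu * (1 - s ^ 3) in
  uanalytic D (fun s _ => sqrt (4 - v s ^ 2)) /\
  uanalytic D (fun s _ => / posS (v s) (m2 s) (s ^ 3)) /\
  uanalytic D (fun s _ => x1 (v s) (m2 s) (s ^ 3)) /\
  uanalytic D (fun s _ => x2 (v s) (m2 s) (s ^ 3)) /\
  uanalytic D (fun s _ => y2 (v s) (m2 s) (s ^ 3)) /\
  uanalytic D (fun s _ => x3 (v s) (m2 s) (s ^ 3)) /\
  uanalytic D (fun s _ => y3 (v s) (m2 s) (s ^ 3)).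
Proof.
  intros hmu v m2.
  assert (hv : uanalytic D (fun s _ => v s)) by apply uanalytic_side.
  assert (hm : uanalytic D (fun s _ => m2 s)) by (unfold m2; uanalytic).
  assert (v0 : v 0 = 1) by apply side_0.
  assert (m20 : m2 0 = mu) by (unfold m2; ring).
  assert (hg : uanalytic D (fun s _ => sqrt (4 - v s ^ 2))).
  { apply (uanalytic_sqrt D _ 3); [lra | | uanalytic]. intros w _. rewrite v0. ring. }
  assert (hS : uanalytic D (fun s _ => posS (v s) (m2 s) (s ^ 3))).
  { unfold posS. apply (uanalytic_sqrt D _ (mu ^ 2)); [nra | | uanalytic].
    intros w _. rewrite v0, m20. ring. }
  assert (hS' : uanalytic D (fun s _ => / posS (v s) (m2 s) (s ^ 3))).
  { apply (uanalytic_inv D _ mu); [exact hmu | | exact hS].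
    intros w _. unfold posS. rewrite v0, m20. rewrite <- (sqrt_pow2 mu) by lra.
    f_equal. rewrite sqrt_pow2 by lra. ring. }
  clearbody v m2.
  assert (half : forall F : R -> phase -> R, uanalytic D F ->
    uanalytic D (fun s w => F s w / (2 * posS (v s) (m2 s) (s ^ 3)))).
  { intros F hF.
    apply (uanalytic_ext D (fun s w => F s w * (/ 2 * / posS (v s) (m2 s) (s ^ 3))));
      [|uanalytic].
    intros s w. unfold Rdiv. now rewrite Rinv_mult. }
  repeat split.
  - exact hg.
  - exact hS'.
  - unfold x1. uanalytic.
  - unfold x2. apply half. uanalytic.
  - unfold y2.
    apply (uanalytic_opp D (fun s _ =>
      v s * sqrt (4 - v s ^ 2) * s ^ 3 / (2 * posS (v s) (m2 s) (s ^ 3)))).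
    apply half. uanalytic.
  - unfold x3. apply half. uanalytic.
  - unfold y3. apply half. uanalytic.
Qed.

Lemma uanalytic_along (L mu rho3 C20 : R) :
  0 < mu ->
  let v s := side (s * rho3) C20 in
  let m2 s := mu * (1 - s ^ 3) in
  uanalytic (away L) (fun s w => along1 (v s) (m2 s) (s ^ 3) (posx w) (posy w)) /\
  uanalytic (away L) (fun s w => along2 (v s) (m2 s) (s ^ 3) (posx w) (posy w)).
Proof.
  intros hmu v m2.
  destruct (uanalytic_positions (away L) mu rho3 C20 hmu)
    as (_ & _ & h1 & h2 & k2 & h3 & k3).
  destruct (uanalytic_coordinates L) as (hx & hy & _).
  unfold along1, along2, y1. split; uanalytic.
Qed.

Lemma uanalytic_stretch (D : phase -> Prop) (E Q : R -> phase -> R) :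
  uanalytic D E -> uanalytic D Q ->
  uanalytic D (fun s w => stretch s (E s w) (Q s w)).
Proof.
  intros hE hQ. unfold stretch. uanalytic.
Qed.

Lemma uanalytic_norm2 (L : R) :
  uanalytic (away L) (fun _ w => posx w ^ 2 + posy w ^ 2 + posz w ^ 2).
Proof.
  destruct (uanalytic_coordinates L) as (hx & hy & hz).
  uanalytic.
Qed.

Lemma uanalytic_neglected_terms (L mu rho3 C20 : R) :
  0 < mu ->
  uanalytic (away L)
    (fun s w => neglected_terms mu rho3 C20 s (posx w) (posy w) (posz w)).
Proof.
  intros hmu.
  destruct (uanalytic_side (away L) rho3 C20) as [hom hv].
  destruct (uanalytic_positions (away L) mu rho3 C20 hmu)
    as (hg & hS & _ & _ & _ & h3 & k3).
  destruct (uanalytic_along L mu rho3 C20 hmu) as [e1 e2].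
  pose proof (uanalytic_norm2 L) as hq.
  pose proof (uanalytic_stretch _ _ _ e1 hq) as t1.
  pose proof (uanalytic_stretch _ _ _ e2 hq) as t2.
  cbv beta in t1, t2.
  destruct (uanalytic_coordinates L) as (hx & hy & hz).
  assert (hr : uanalytic (away L)
                 (fun _ w => / sqrt (posx w ^ 2 + posy w ^ 2 + posz w ^ 2))).
  { apply (uanalytic_const _ _ L). intros w (_ & _ & _ & hp & hl).
    rewrite Rabs_pos_eq; [exact hl|].
    left. now apply Rinv_0_lt_compat, sqrt_lt_R0. }
  assert (hS2 : uanalytic (away L) (fun s _ =>
    / (4 * posS (side (s * rho3) C20) (mu * (1 - s ^ 3)) (s ^ 3) ^ 2))).
  { apply (uanalytic_ext _ (fun s _ =>
      / 4 * (/ posS (side (s * rho3) C20) (mu * (1 - s ^ 3)) (s ^ 3)) ^ 2)); [|uanalytic].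
    intros s _. now rewrite Rinv_mult, pow_inv. }
  assert (d1 : uanalytic (away L) (fun s w => along1_defect (side (s * rho3) C20)
    (mu * (1 - s ^ 3)) (s ^ 3) (posx w) (posy w))) by (unfold along1_defect; uanalytic).
  assert (d2 : uanalytic (away L) (fun s w => along2_defect (side (s * rho3) C20)
    (mu * (1 - s ^ 3)) (s ^ 3) (posx w) (posy w))) by (unfold along2_defect; uanalytic).
  (* The argument [s * t1] vanishes at [s = 0] by [Rmult_0_l]. *)
  assert (c1 := uanalytic_cubic_remainder _ _ (fun w _ => Rmult_0_l _)
                  (uanalytic_mult _ _ _ (uanalytic_var _) t1)).
  assert (c2 := uanalytic_cubic_remainder _ _ (fun w _ => Rmult_0_l _)
                  (uanalytic_mult _ _ _ (uanalytic_var _) t2)).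
  cbv beta in c1, c2.
  unfold neglected_terms. cbv zeta. uanalytic.
Qed.

(** * The change of coordinates and the Hill limit *)

Lemma cube_root_sqr (m : R) : Rpower m (2 / 3) = Rpower m (1 / 3) ^ 2.
Proof.
  rewrite <- Rpower_pow by apply exp_pos. rewrite Rpower_mult.
  f_equal. simpl. field.
Qed.

Lemma cube_root_cube (m : R) : 0 < m -> Rpower m (1 / 3) ^ 3 = m.
Proof.
  intros hm. rewrite <- Rpower_pow by apply exp_pos. rewrite Rpower_mult.
  replace (1 / 3 * INR 3) with 1 by (simpl; field). now apply Rpower_1.
Qed.

(** The map is affine: the translation drops out of the differential [scaling s], which multiplies
    each product in [sympl] by [s ^ 2]. *)
Lemma conformally_symplectic_hill_change (m2 m3 R3 C20 : R) :
  conformally_symplectic (Rpower m3 (2 / 3)) (hill_change m2 m3 R3 C20).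
Proof.
  unfold hill_change. set (v := side R3 C20).
  set (a := x3 v m2 m3). set (b := y3 v m2 m3).
  rewrite cube_root_sqr.
  set (s := Rpower m3 (1 / 3)). intros w. exists (scaling s). split.
  - apply (filterdiff_ext (fun w' : phase =>
      plus (scal s w') ((a, b, 0, - b, a, 0) : phase))).
    { intros [[[[[x y] z] px] py] pz].
      change ((s * x + a, s * y + b, s * z + 0, s * px + - b, s * py + a, s * pz + 0)
        = (s * x + a, s * y + b, s * z, s * px - b, s * py + a, s * pz) :> phase).
      now rewrite !Rplus_0_r. }
    apply (filterdiff_ext_lin _ (fun w' : phase => plus (scal s w') zero)).
    + apply (filterdiff_plus_fct (fun w' : phase => scal s w')
               (fun _ => ((a, b, 0, - b, a, 0) : phase))
               (fun w' => scal s w') (fun _ => zero)).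
      * apply filterdiff_linear. exact (@is_linear_scal_r R_AbsRing _ s Rmult_comm).
      * apply filterdiff_const.
    + intros [[[[[x y] z] px] py] pz]. rewrite plus_zero_r. reflexivity.
  - intros [[[[[x y] z] px] py] pz] [[[[[x' y'] z'] px'] py'] pz'].
    unfold sympl, scaling. ring.
Qed.

(** The remainder is [s] times [neglected_terms], which shifts the Taylor coefficients by one index
    and leaves 0 in front. *)
Definition remainder_coef (mu rho3 C20 : R) (n : nat) (w : phase) : R :=
  match n with
  | O => 0
  | S m => taylor (fun s w =>
      neglected_terms mu rho3 C20 s (posx w) (posy w) (posz w)) m w
  end.

Lemma cube_root_lt (m d : R) : 0 < m -> 0 < d -> m < d ^ 3 -> Rpower m (1 / 3) < d.
Proof.
  intros hm hd h. apply Rnot_le_lt. intros hle. apply (Rlt_not_le _ _ h).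
  rewrite <- (cube_root_cube m hm). apply pow_incr. lra.
Qed.

Theorem theorem3p1 (mu rho3 C20 : R)
  (hmu : 0 < mu <= 1 / 2) (hrho3 : 0 < rho3) (hC20 : C20 < 0) :
  (forall m1 m2 m3 R3 : R, admissible mu rho3 m1 m2 m3 R3 ->
     conformally_symplectic (Rpower m3 (2 / 3)) (hill_change m2 m3 R3 C20) /\
     rho3 ^ 2 * C20 / 2 = Rpower m3 (- (2 / 3)) * R3 ^ 2 * C20 / 2 /\
     (forall w : phase,
        Hhill_rho mu (side R3 C20) rho3 C20 w
        = Hhill_c mu (side R3 C20) (rho3 ^ 2 * C20 / 2) w)) /\
  exists (E : R -> R) (a : nat -> phase -> R),
    (forall w : phase, a O w = 0) /\
    forall w0 : phase, off_tertiary w0 ->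
      exists delta M : R, 0 < delta /\
        locally w0 (fun w : phase =>
          forall m1 m2 m3 R3 : R, admissible mu rho3 m1 m2 m3 R3 ->
            m3 < delta ->
            let K := transformed (Rpower m3 (2 / 3)) (hill_change m2 m3 R3 C20)
                       (H4body m1 m2 m3 R3 C20) in
            let remainder :=
              K w - E m3 - Hhill_rho mu (side R3 C20) rho3 C20 w in
            is_pseries (fun n => a n w) (Rpower m3 (1 / 3)) remainder /\
            Rabs remainder <= M * Rpower m3 (1 / 3)).
Proof.
  split.
  { intros m1 m2 m3 R3 (_ & _ & h3 & _ & _ & hR).
    assert (hs : 0 < Rpower m3 (1 / 3)) by apply exp_pos. repeat split.
    - apply conformally_symplectic_hill_change.
    - rewrite hR, Rpower_Ropp, cube_root_sqr. field. lra.
    - intros [[[[[x y] z] px] py] pz]. unfold Hhill_rho, Hhill_c, Rdiv. ring. }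
  exists (hill_constant mu rho3 C20), (remainder_coef mu rho3 C20).
  split; [reflexivity|].
  intros w0 h0. destruct (locally_away w0 h0) as [L hL].
  destruct (uanalytic_taylor _ _ (uanalytic_neglected_terms L mu rho3 C20 (proj1 hmu)))
    as (d & M & hd & HT).
  destruct (uanalytic_along L mu rho3 C20 (proj1 hmu)) as [e1 e2].
  pose proof (uanalytic_stretch _ _ _ e1 (uanalytic_norm2 L)) as t1.
  pose proof (uanalytic_stretch _ _ _ e2 (uanalytic_norm2 L)) as t2.
  destruct (uanalytic_one_plus _ _ t1) as (d1 & hd1 & H1).
  destruct (uanalytic_one_plus _ _ t2) as (d2 & hd2 & H2).
  cbv beta in H1, H2.
  (* 1 serves [hill_remainder], [d] the Taylor expansion, [d1] and [d2] the positivity of the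
     squared distances. *)
  set (d0 := Rmin 1 (Rmin d (Rmin d1 d2))).
  assert (hd0 : 0 < d0 /\ d0 <= 1 /\ d0 <= d /\ d0 <= d1 /\ d0 <= d2).
  { unfold d0, Rmin. repeat destruct Rle_dec; lra. }
  (* The bound is on [m3 = s ^ 3], hence the cube. *)
  exists (d0 ^ 3), M. split; [apply pow_lt; lra|].
  revert hL. apply filter_imp.
  intros w hw m1 m2 m3 R3 (g1 & g2 & h3 & hsum & hm & hR) hlt K rem.
  assert (hm2 : m2 = mu * (1 - m3)).
  { rewrite hm. replace (1 - m3) with (m1 + m2) by lra. field. lra. }
  assert (hm1 : m1 = (1 - mu) * (1 - m3)) by lra.
  assert (hs : 0 < Rpower m3 (1 / 3)) by apply exp_pos.
  pose proof (cube_root_cube m3 h3) as e3.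
  pose proof (cube_root_lt m3 d0 h3 (proj1 hd0) hlt) as hsd.
  assert (erem : rem = Rpower m3 (1 / 3)
    * neglected_terms mu rho3 C20 (Rpower m3 (1 / 3)) (posx w) (posy w) (posz w)).
  { unfold rem, K, transformed, hill_change, hill_constant.
    rewrite cube_root_sqr, hR, hm1, hm2.
    set (s := Rpower m3 (1 / 3)) in *. rewrite <- e3.
    assert (has : Rabs s < d0) by (rewrite Rabs_pos_eq; lra).
    specialize (H1 s w ltac:(lra) hw). specialize (H2 s w ltac:(lra) hw).
    destruct hw as (_ & _ & _ & hq & _).
    destruct w as [[[[[x y] z] px] py] pz].
    apply hill_remainder; trivial; lra. }
  set (s := Rpower m3 (1 / 3)) in *.
  assert (has : Rabs s < d) by (rewrite Rabs_pos_eq; lra).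
  destruct (HT s w has hw) as [hser hbd]. rewrite erem. split.
  - exact (is_pseries_incr_1 _ _ _ hser).
  - rewrite Rabs_mult, (Rabs_pos_eq s) by lra.
    rewrite Rmult_comm. apply Rmult_le_compat_r; lra.
Qed.
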